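(* Let $(\lambda_\alpha)_{\alpha\in(0,\alpha_1]}$ be drift rates such that $\mathcal{V}_\alpha=\mathcal{V}_0+\alpha\mathcal{M}$ is $(\lambda_\alpha,A'_\alpha)$-admissible for $\mathcal{L}_\alpha$ and $\lambda_\alpha\ge\lambda+\delta\alpha-C_\lambda\alpha^2$ for $\alpha\in(0,\alpha_1]$, with $\lambda_0:=\lambda$, $\delta>0$ and $C_\lambda\ge0$. Assume that at $\alpha=0$ the Lyapunov branch is strictly active, i.e. $\widetilde\Lambda_{1,0}(\lambda)<\widetilde\Lambda_{2,0}(\lambda)$ and $\widetilde\Lambda_{1,0}(\lambda)<\widetilde\Lambda_{3,0}(\lambda)$, and that $\alpha\mapsto\widetilde\Lambda_{i,\alpha}(\lambda_\alpha)$ is continuous on $[0,\alpha_1]$ for $i=1,2,3$. Let $$\Delta(\alpha):=\min\{\widetilde\Lambda_{2,\alpha}(\lambda_\alpha),\widetilde\Lambda_{3,\alpha}(\lambda_\alpha)\}-\widetilde\Lambda_{1,\alpha}(\lambda_\alpha),\qquad\alpha_{\mathrm{branch}}:=\sup\{\alpha\in(0,\alpha_1]:\Delta(\beta)>0\ \forall\beta\in[0,\alpha]\}.$$ Let $c_\alpha:=\frac{\gamma}{384}\min_{i=1,2,3}\widetilde\Lambda_{i,\alpha}(\lambda_\alpha)$ be the HFHR contraction rate and $c_0:=\frac{\gamma}{384}\min_{i=1,2,3}\widetilde\Lambda_{i,0}(\lambda)$ the kinetic Langevin rate. Put $$\kappa:=\frac{L(\delta+\gamma\lambda)}{768\,\gamma},\qquad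 C':=\frac{L}{384\gamma}(1+\gamma)\left(C_2+\widetilde C_{\mathcal{M}}\,\underline c_{\mathrm{imp}}\right),\qquad\alpha_{\mathrm{branch,acc}}:=\min\left\{\alpha_{\mathrm{branch}},1,\frac{\kappa}{C'}\right\}\in(0,\alpha_{\mathrm{branch}}].$$ Then for all $\alpha\in(0,\alpha_{\mathrm{branch,acc}}]$, $\ c_\alpha\ge c_0+\kappa\alpha$.
   Context: Fix an integer $d\ge1$, $\gamma>0$ and $\kappa_{\mathrm{adjust}}\in(0,1)$; $|\cdot|$ is the Euclidean norm, $\|\cdot\|_{\mathrm{op}}$ the operator norm; points of $\mathbb{R}^{2d}$ are $z=(q,p)$. Assumption 1 on $U:\mathbb{R}^d\to\mathbb{R}$: there are constants $L,A\in(0,\infty)$, $\lambda\in(0,1/4]$ such that (i) $U\in C^1$, $U\ge0$; (ii) $\nabla U$ is $L$-Lipschitz; (iii) $\frac12q\cdot\nabla U(q)\ge\lambda\left(U(q)+\frac{\gamma^2}{4}|q|^2\right)-A$ for all $q$. Put $\mathcal{V}_0(q,p)=U(q)+\frac{\gamma^2}{4}\left(|q+\gamma^{-1}p|^2+|\gamma^{-1}p|^2-\lambda|q|^2\right)$. Assumption 2: there are $C_{\mathrm{linear}}>0$, a symmetric positive definite $Q_\infty\in\mathbb{R}^{d\times d}$ and a nonincreasing $\varrho:[0,\infty)\to[0,\infty)$ with $\varrho(r)\to0$ as $r\to\infty$ and $|\nabla U(q)-Q_\infty q|\le\varrho(|q|)|q|$ for $|q|\ge C_{\mathrm{linear}}$.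 Generator of the HFHR dynamics: $\mathcal{L}_\alpha\varphi=(p-\alpha\nabla U)\cdot\nabla_q\varphi+(-\gamma p-\nabla U)\cdot\nabla_p\varphi+\alpha\Delta_q\varphi+\gamma\Delta_p\varphi$ ($\alpha=0$: kinetic Langevin dynamics). Put $\mathcal{A}_0:=p\cdot\nabla_q+(-\gamma p-\nabla U)\cdot\nabla_p$, $\mathcal{A}':=-\nabla U\cdot\nabla_q$. A function $\mathcal{V}:\mathbb{R}^{2d}\to[0,\infty)$, $C^2$ or $C^1$ with locally Lipschitz derivatives, is $(\ell,E)$-admissible for $\mathcal{L}_\alpha$ if $\mathcal{L}_\alpha\mathcal{V}\le\gamma(d+E-\ell\mathcal{V})$ a.e. Corrector: let $B=\begin{pmatrix}0&I_d\\-Q_\infty&-\gamma I_d\end{pmatrix}$, $B_1(q,p)=|Q_\infty q|^2+\frac{\gamma^2}{2}(1-\lambda)\langle Q_\infty q,q\rangle+\frac\gamma2\langle Q_\infty q,p\rangle-\left(\frac12|p|^2+\frac\gamma2\langle q,p\rangle+\frac12\langle(Q_\infty+\frac{\gamma^2}{2}(1-\lambda)I_d)q,q\rangle\right)$, $C_{B_1}=\nabla^2B_1$, $\mathsf{K}$ the unique symmetric solution of $B^\top\mathsf{K}+\mathsf{K}B=C_{B_1}$, with $d\times d$ blocks $\mathsf{K}_{qq},\mathsf{K}_{qp},\mathsf{K}_{pq},\mathsf{K}_{pp}$, and $\mathcal{M}(z)=\frac12z^\top\mathsf{K}z$. Constants: $a_{\min}=\lambda_{\min}(Q_\infty)+\frac{\gamma^2}{2}(1-\lambda)$,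 $a_{\max}=\lambda_{\max}(Q_\infty)+\frac{\gamma^2}{2}(1-\lambda)$, $\underline a=\frac14\left(a_{\min}+1-\sqrt{(a_{\min}-1)^2+\gamma^2}\right)$, $H=2(\|\mathsf{K}_{pq}\|_{\mathrm{op}}+\|\mathsf{K}_{pp}\|_{\mathrm{op}})+4\lambda_{\max}(Q_\infty)+\gamma^2|1-\lambda|+\gamma$, $\rho_\star=\frac12\left(-H+\sqrt{H^2+\frac54\underline a}\right)$; for $R\ge1$, $\rho_\nabla(R)=\sup_{|q|\ge R}\frac{|\nabla U(q)-Q_\infty q|}{|q|}$, $\delta_U(R)=\sup_{|q|\ge R}\frac{|U(q)-\frac12\langle Q_\infty q,q\rangle|}{1+|q|^2}$; $R_0=\inf\{R\ge\max\{1,C_{\mathrm{linear}}\}:\rho_\nabla(R)\le\rho_\star\}$; $$\underline c_{\mathrm{imp}}=\frac38\cdot\frac{a_{\min}+1-\sqrt{(a_{\min}-1)^2+\gamma^2}}{a_{\max}+1+\sqrt{(a_{\max}-1)^2+\gamma^2}+8\delta_U(R_0)},\quad C_{\mathrm{imp}}=\sup_{|q|\le R_0,\,p\in\mathbb{R}^d}\{\mathcal{A}_0\mathcal{M}+\mathcal{A}'\mathcal{V}_0+\underline c_{\mathrm{imp}}\mathcal{V}_0\}.$$ $\mu_{\min}=\frac18\left(\gamma^2(1-\lambda)+2-\sqrt{(\gamma^2(1-\lambda)-2)^2+4\gamma^2}\right)$, $c_1=\min(1,\mu_{\min})$, $C_{\mathcal{M}}=\frac12\|\mathsf{K}\|_{\mathrm{op}}$,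 $\widetilde C_{\mathcal{M}}=C_{\mathcal{M}}/c_1$, $C_1=C_{\mathrm{imp}}+\gamma\,\mathrm{tr}(\mathsf{K}_{pp})+dL+\frac{\gamma^2}{2}d|1-\lambda|$, $C_2=|\mathrm{tr}(\mathsf{K}_{qq})|+3C_{\mathcal{M}}\frac{L+|\nabla U(0)|}{c_1}$, $\delta=\underline c_{\mathrm{imp}}-\lambda\widetilde C_{\mathcal{M}}$, $C_\lambda=C_2+\widetilde C_{\mathcal{M}}\underline c_{\mathrm{imp}}$, $A'_\alpha=A+\frac\alpha\gamma[C_1+\alpha C_2+\widetilde C_{\mathcal{M}}(\lambda+\underline c_{\mathrm{imp}})]$, $\alpha_0=\frac{\gamma\lambda}{2}\left\{\frac1{c_1}\left[\frac{\gamma^4}{4}(1-\lambda)^2+\frac{\gamma^2}{4}\right]+Ld+\frac{\gamma^2}{2}d(1-\lambda)\right\}^{-1}$, $\alpha_1=\min\{\alpha_0,1,\frac{c_1}{2C_{\mathcal{M}}},\alpha_{\mathrm{pos}}\}$, where $\alpha_{\mathrm{pos}}>0$ is any constant with $\lambda+\delta\alpha-C_\lambda\alpha^2\ge\lambda/2$ on $(0,\alpha_{\mathrm{pos}}]$. Rate branches: $L_{\mathrm{eff}}(\alpha)=(1+\alpha\gamma)L$, $\theta_0=L\gamma^{-2}$, $J_2=\frac{12}{5}(1+2\theta_0+2\theta_0^2)\frac{d+A}{\gamma^2(1-2\lambda)}$, $h(x)=\sqrt xe^{-x}$, and for $\ell>0$: $\Lambda_\alpha(\ell)=J_2L_{\mathrm{eff}}(\alpha)/\ell$,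 $\widetilde\Lambda_{1,\alpha}(\ell)=\frac{\ell L_{\mathrm{eff}}(\alpha)}{\gamma^2}$ (Lyapunov branch), $\widetilde\Lambda_{2,\alpha}(\ell)=h(\Lambda_\alpha(\ell))\frac{L_{\mathrm{eff}}(\alpha)}{\gamma^2}$, $\widetilde\Lambda_{3,\alpha}(\ell)=\kappa_{\mathrm{adjust}}h(\Lambda_\alpha(\ell))$ (metric branches). *)

(* Defs.v *)
From HB Require Import structures.
From mathcomp Require Import all_boot all_order all_algebra.
From mathcomp Require Import all_classical all_reals all_analysis.

Set Implicit Arguments.
Unset Strict Implicit.
Unset Printing Implicit Defensive.

Import Order.TTheory GRing.Theory Num.Theory.
Import numFieldNormedType.Exports.

Local Open Scope classical_set_scope.
Local Open Scope ring_scope.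

Section euclidean.
Context {R : realType}.

Definition dot n (x y : 'cV[R]_n) : R := \sum_i x i 0 * y i 0.

(* The library norm on matrices is the sup norm, hence this definition. *)
Definition enorm n (x : 'cV[R]_n) : R := Num.sqrt (dot x x).

Definition opnorm m n (M : 'M[R]_(m, n)) : R :=
  sup [set enorm (M *m x) | x in [set x : 'cV[R]_n | enorm x <= 1]].

Definition spd n (Q : 'M[R]_n) : Prop :=
  Q^T = Q /\ forall x : 'cV[R]_n, x != 0 -> 0 < dot x (Q *m x).

(* Only used for symmetric matrices, whose eigenvalues are all real. *)
Definition lambda_min n (Q : 'M[R]_n) : R := inf [set a | eigenvalue Q a].
Definition lambda_max n (Q : 'M[R]_n) : R := sup [set a | eigenvalue Q a].

Definition partial n (i : 'I_n) (f : 'cV[R]_n -> R) (x : 'cV[R]_n) : R :=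
  'D_(delta_mx i 0) f x.

Definition grad n (f : 'cV[R]_n -> R) (x : 'cV[R]_n) : 'cV[R]_n :=
  \col_i partial i f x.

Definition hess n (f : 'cV[R]_n -> R) (x : 'cV[R]_n) : 'M[R]_n :=
  \matrix_(i, j) partial i (partial j f) x.

Definition is_C1 n (f : 'cV[R]_n -> R) : Prop :=
  (forall x, differentiable f x) /\ continuous (grad f).

Definition is_C2 n (f : 'cV[R]_n -> R) : Prop :=
  is_C1 f /\ forall i, is_C1 (partial i f).

(* Lebesgue null sets of R^n: covered by countably many closed boxes of
   arbitrarily small total volume. *)
Definition lebesgue_null n (N : set 'cV[R]_n) : Prop :=
  forall eps : R, 0 < eps -> exists a b : nat -> 'cV[R]_n,
    [/\ forall k i, a k i 0 <= b k i 0,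
        N `<=` \bigcup_k [set x | forall i, a k i 0 <= x i 0 <= b k i 0] &
        (\sum_(0 <= k <oo) (\prod_i (b k i 0 - a k i 0))%:E <= eps%:E)%E].

Definition lebesgue_ae n (S : 'cV[R]_n -> Prop) : Prop :=
  lebesgue_null [set x | ~ S x].

End euclidean.

Section phase_space.
Context {R : realType} {d : nat}.
Implicit Types (z : 'cV[R]_(d + d)) (phi : 'cV[R]_(d + d) -> R).

(* A point z = (q, p) of R^{2d} is the column [col_mx q p]. *)
Definition pos_of z : 'cV[R]_d := usubmx z.
Definition mom_of z : 'cV[R]_d := dsubmx z.

Definition grad_q phi z : 'cV[R]_d := usubmx (grad phi z).
Definition grad_p phi z : 'cV[R]_d := dsubmx (grad phi z).

Definition lap_q phi z : R :=
  \sum_(i < d) partial (lshift d i) (partial (lshift d i) phi) z.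
Definition lap_p phi z : R :=
  \sum_(i < d) partial (rshift d i) (partial (rshift d i) phi) z.

End phase_space.

(* [Kcor] is the matrix written K (sans serif) in the paper and [Clin] is
   C_linear. The fields are bare data; the hypotheses on them are [standing],
   [assumption1], [assumption2] and [corrector]. *)
Record hfhr (R : realType) (d : nat) := HFHR {
  gamma : R;
  kappa_adjust : R;
  potential : 'cV[R]_d -> R;
  Lip : R;
  Acst : R;
  lam : R;
  Clin : R;
  Qinf : 'M[R]_d;
  Kcor : 'M[R]_(d + d) }.

Section hfhr.
Context {R : realType} {d : nat}.
Variable P : hfhr R d.

Local Notation gamma := (gamma P).
Local Notation kappa_adjust := (kappa_adjust P).
Local Notation U := (potential P).
Local Notation L := (Lip P).
Local Notation A := (Acst P).
Local Notation lam := (lam P).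
Local Notation Clin := (Clin P).
Local Notation Q := (Qinf P).
Local Notation K := (Kcor P).

Implicit Types (q p : 'cV[R]_d) (z : 'cV[R]_(d + d)).
Implicit Types phi V : 'cV[R]_(d + d) -> R.
Implicit Types alpha ell : R.

Definition standing : Prop :=
  [/\ (0 < d)%N, 0 < gamma & 0 < kappa_adjust < 1].

Definition assumption1 : Prop :=
  [/\ 0 < L, 0 < A & 0 < lam <= 4^-1] /\
  [/\ is_C1 U, forall q, 0 <= U q,
      forall q q', enorm (grad U q - grad U q') <= L * enorm (q - q') &
      forall q, lam * (U q + gamma ^+ 2 / 4 * enorm q ^+ 2) - A
                <= 2^-1 * dot q (grad U q)].

Definition assumption2 : Prop :=
  [/\ 0 < Clin, spd Q &
    exists varrho : R -> R,
    [/\ forall r : R, 0 <= r -> 0 <= varrho r,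
        forall r s : R, 0 <= r -> r <= s -> varrho s <= varrho r,
        varrho r @[r --> +oo] --> (0 : R) &
        forall q, Clin <= enorm q ->
          enorm (grad U q - Q *m q) <= varrho (enorm q) * enorm q]].

Definition V0 z : R :=
  let q := pos_of z in let p := mom_of z in
  U q + gamma ^+ 2 / 4 *
    (enorm (q + gamma^-1 *: p) ^+ 2 + enorm (gamma^-1 *: p) ^+ 2
     - lam * enorm q ^+ 2).

Definition generator alpha phi z : R :=
  let q := pos_of z in let p := mom_of z in
  dot (p - alpha *: grad U q) (grad_q phi z)
  + dot (- (gamma *: p) - grad U q) (grad_p phi z)
  + alpha * lap_q phi z + gamma * lap_p phi z.

Definition A0op phi z : R :=
  let q := pos_of z in let p := mom_of z in
  dot p (grad_q phi z) + dot (- (gamma *: p) - grad U q) (grad_p phi z).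

Definition A1op phi z : R := - dot (grad U (pos_of z)) (grad_q phi z).

(* For C^1 functions with locally Lipschitz derivatives, second partial
   derivatives exist almost everywhere (Rademacher), so the default value of
   ['D_v f x] at other points does not affect the inequality. *)
Definition admissible alpha ell (E : R) V : Prop :=
  [/\ forall z, 0 <= V z,
      is_C2 V \/ (is_C1 V /\ [locally [lipschitz grad V z | z in setT]]) &
      lebesgue_ae (fun z =>
        generator alpha V z <= gamma * (d%:R + E - ell * V z))].

Definition Bmat : 'M[R]_(d + d) :=
  block_mx 0 1%:M (- Q) (- gamma%:M).

Definition B1 z : R :=
  let q := pos_of z in let p := mom_of z in
  enorm (Q *m q) ^+ 2 + gamma ^+ 2 / 2 * (1 - lam) * dot (Q *m q) q
  + gamma / 2 * dot (Q *m q) p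
  - (2^-1 * enorm p ^+ 2 + gamma / 2 * dot q p
     + 2^-1 * dot ((Q + (gamma ^+ 2 / 2 * (1 - lam))%:M) *m q) q).

(* [B1] is a quadratic form, so its Hessian is the same at every point. *)
Definition CB1 : 'M[R]_(d + d) := hess B1 0.

(* [Bmat] is Hurwitz, so this Lyapunov equation has exactly one solution. *)
Definition corrector : Prop :=
  K^T = K /\ Bmat^T *m K + K *m Bmat = CB1.

Definition Kqq : 'M[R]_d := ulsubmx K.
Definition Kpq : 'M[R]_d := dlsubmx K.
Definition Kpp : 'M[R]_d := drsubmx K.

Definition Mcor z : R := 2^-1 * dot z (K *m z).

Definition Valpha alpha z : R := V0 z + alpha * Mcor z.

Definition a_min : R := lambda_min Q + gamma ^+ 2 / 2 * (1 - lam).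
Definition a_max : R := lambda_max Q + gamma ^+ 2 / 2 * (1 - lam).

Definition a_low : R :=
  4^-1 * (a_min + 1 - Num.sqrt ((a_min - 1) ^+ 2 + gamma ^+ 2)).

Definition Hcst : R :=
  2 * (opnorm Kpq + opnorm Kpp) + 4 * lambda_max Q
  + gamma ^+ 2 * `|1 - lam| + gamma.

Definition rho_star : R :=
  2^-1 * (- Hcst + Num.sqrt (Hcst ^+ 2 + 5 / 4 * a_low)).

(* Under the assumptions above, the sets in [rho_grad] and [delta_U] (for
   r >= 1), [R0] and [C_imp] are nonempty and bounded on the relevant side, so
   [sup] and [inf] do not take their default value there. *)
Definition rho_grad (r : R) : R :=
  sup [set enorm (grad U q - Q *m q) / enorm q
      | q in [set q : 'cV[R]_d | r <= enorm q]].

Definition delta_U (r : R) : R :=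
  sup [set `|U q - 2^-1 * dot (Q *m q) q| / (1 + enorm q ^+ 2)
      | q in [set q : 'cV[R]_d | r <= enorm q]].

Definition R0 : R :=
  inf [set r : R | Num.max 1 Clin <= r /\ rho_grad r <= rho_star].

Definition c_imp : R :=
  3 / 8 * ((a_min + 1 - Num.sqrt ((a_min - 1) ^+ 2 + gamma ^+ 2))
           / (a_max + 1 + Num.sqrt ((a_max - 1) ^+ 2 + gamma ^+ 2)
              + 8 * delta_U R0)).

Definition C_imp : R :=
  sup [set A0op Mcor z + A1op V0 z + c_imp * V0 z
      | z in [set z : 'cV[R]_(d + d) | enorm (pos_of z) <= R0]].

Definition mu_min : R :=
  8^-1 * (gamma ^+ 2 * (1 - lam) + 2
          - Num.sqrt ((gamma ^+ 2 * (1 - lam) - 2) ^+ 2 + 4 * gamma ^+ 2)).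

Definition c1 : R := Num.min 1 mu_min.
Definition CM : R := 2^-1 * opnorm K.
Definition CMtilde : R := CM / c1.

Definition C1cst : R :=
  C_imp + gamma * \tr Kpp + d%:R * L + gamma ^+ 2 / 2 * d%:R * `|1 - lam|.

Definition C2cst : R :=
  `|\tr Kqq| + 3 * CM * ((L + enorm (grad U 0)) / c1).

Definition delta : R := c_imp - lam * CMtilde.
Definition C_lambda : R := C2cst + CMtilde * c_imp.

Definition A' alpha : R :=
  A + alpha / gamma * (C1cst + alpha * C2cst + CMtilde * (lam + c_imp)).

Definition alpha0 : R :=
  gamma * lam / 2 *
  (c1^-1 * (gamma ^+ 4 / 4 * (1 - lam) ^+ 2 + gamma ^+ 2 / 4)
   + L * d%:R + gamma ^+ 2 / 2 * d%:R * (1 - lam))^-1.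

Definition is_alpha_pos (apos : R) : Prop :=
  0 < apos /\
  forall alpha, 0 < alpha <= apos ->
    lam / 2 <= lam + delta * alpha - C_lambda * alpha ^+ 2.

Definition alpha1 (apos : R) : R :=
  Num.min alpha0 (Num.min 1 (Num.min (c1 / (2 * CM)) apos)).

Definition Leff alpha : R := (1 + alpha * gamma) * L.
Definition theta0 : R := L * gamma ^- 2.
Definition J2 : R :=
  12 / 5 * (1 + 2 * theta0 + 2 * theta0 ^+ 2)
  * ((d%:R + A) / (gamma ^+ 2 * (1 - 2 * lam))).
Definition hfun (x : R) : R := Num.sqrt x * expR (- x).

Definition Lam alpha ell : R := J2 * Leff alpha / ell.
Definition tLam1 alpha ell : R := ell * Leff alpha / gamma ^+ 2.
Definition tLam2 alpha ell : R := hfun (Lam alpha ell) * (Leff alpha / gamma ^+ 2).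
Definition tLam3 alpha ell : R := kappa_adjust * hfun (Lam alpha ell).

(* [lam_ alpha] is the drift rate lambda_alpha. *)
Definition drift_rates (apos : R) (lam_ : R -> R) : Prop :=
  lam_ 0 = lam /\
  forall alpha, 0 < alpha <= alpha1 apos ->
    admissible alpha (lam_ alpha) (A' alpha) (Valpha alpha) /\
    lam + delta * alpha - C_lambda * alpha ^+ 2 <= lam_ alpha.

Definition Delta (lam_ : R -> R) alpha : R :=
  Num.min (tLam2 alpha (lam_ alpha)) (tLam3 alpha (lam_ alpha))
  - tLam1 alpha (lam_ alpha).

Definition alpha_branch (apos : R) (lam_ : R -> R) : R :=
  sup [set alpha : R | 0 < alpha <= alpha1 apos /\
    forall beta : R, 0 <= beta <= alpha -> 0 < Delta lam_ beta].

Definition rate alpha ell : R :=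
  gamma / 384 *
  Num.min (tLam1 alpha ell) (Num.min (tLam2 alpha ell) (tLam3 alpha ell)).

Definition kappa : R := L * (delta + gamma * lam) / (768 * gamma).

Definition C' : R :=
  L / (384 * gamma) * (1 + gamma) * (C2cst + CMtilde * c_imp).

Definition alpha_branch_acc (apos : R) (lam_ : R -> R) : R :=
  Num.min (alpha_branch apos lam_) (Num.min 1 (kappa / C')).

End hfhr.

(* Main.v *)
(** On [0, alpha_branch] the Lyapunov branch realises the minimum, strictly
    before the endpoint and by continuity at it, so that there
    c_alpha = L / (384 gamma) * (1 + alpha gamma) * lambda_alpha.
    Inserting lambda_alpha >= lambda + delta alpha - C_lambda alpha^2 and
    expanding for alpha <= 1 gives c_alpha >= c_0 + 2 kappa alpha - C' alpha^2,
    and alpha <= kappa / C' absorbs the quadratic term into kappa alpha.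
    The threshold kappa / C' is positive because the corrector K is nonzero:
    the momentum block of the Hessian of B_1 has -1 on its diagonal. *)
Require Import Defs.
From HB Require Import structures.
From mathcomp Require Import all_boot all_order all_algebra.
From mathcomp Require Import all_classical all_reals all_analysis.
From mathcomp Require Import ring lra.

Import Order.TTheory GRing.Theory Num.Theory.
Import numFieldNormedType.Exports.

Local Open Scope classical_set_scope.
Local Open Scope ring_scope.

(** * Euclidean and operator norms, and derivatives along lines *)

Section euclidean.
Set Implicit Arguments.
Unset Strict Implicit.
Context {R : realType}.

Lemma dot_ge0 n (x : 'cV[R]_n) : 0 <= dot x x.
Proof. by apply: sumr_ge0 => i _; rewrite -expr2 sqr_ge0. Qed.

Lemma sqr_enorm n (x : 'cV[R]_n) : enorm x ^+ 2 = dot x x.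
Proof. by rewrite /enorm sqr_sqrtr ?dot_ge0. Qed.

Lemma enorm_ge0 n (x : 'cV[R]_n) : 0 <= enorm x.
Proof. exact: sqrtr_ge0. Qed.

Lemma ler_enorm_coord n (x : 'cV[R]_n) i : `|x i 0| <= enorm x.
Proof.
rewrite -sqrtr_sqr ler_wsqrtr // /dot (bigD1 i) //= -expr2 lerDl.
by apply: sumr_ge0 => j _; rewrite -expr2 sqr_ge0.
Qed.

Lemma enorm_delta n (i : 'I_n) : enorm (delta_mx i 0 : 'cV[R]_n) = 1.
Proof.
rewrite /enorm /dot (bigD1 i) //= big1 => [|j /negPf ji].
  by rewrite mxE !eqxx mulr1 addr0 sqrtr1.
by rewrite mxE ji mul0r.
Qed.

Lemma dotDl n (x y z : 'cV[R]_n) : dot (x + y) z = dot x z + dot y z.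
Proof. by rewrite -big_split; apply: eq_bigr => i _; rewrite mxE mulrDl. Qed.

Lemma dotC n (x y : 'cV[R]_n) : dot x y = dot y x.
Proof. by apply: eq_bigr => i _; rewrite mulrC. Qed.

Lemma dotDr n (x y z : 'cV[R]_n) : dot x (y + z) = dot x y + dot x z.
Proof. by rewrite dotC dotDl !(dotC _ x). Qed.

Lemma dotZr n (x y : 'cV[R]_n) a : dot x (a *: y) = a * dot x y.
Proof.
by rewrite /dot big_distrr; apply: eq_bigr => i _; rewrite mxE mulrCA.
Qed.

Lemma dot_delta n (x : 'cV[R]_n) i : dot x (delta_mx i 0) = x i 0.
Proof.
rewrite /dot (bigD1 i) //= big1 => [|j /negPf ji].
  by rewrite mxE !eqxx mulr1 addr0.
by rewrite mxE ji mulr0.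
Qed.

(** Coordinates of a vector in the unit ball have absolute value at most 1, so each entry of
    [M *m x] is bounded by an absolute row sum. This rules out the default value of [sup] in
    [opnorm]. *)
Lemma opnorm_bounded m n (M : 'M[R]_(m, n)) :
  has_ubound [set enorm (M *m x) | x in [set x : 'cV[R]_n | enorm x <= 1]].
Proof.
exists (Num.sqrt (\sum_i (\sum_j `|M i j|) ^+ 2)) => _ [x /= x1 <-].
rewrite ler_wsqrtr // ler_sum // => i _.
rewrite -expr2 -[leLHS]real_normK ?num_real // lerXn2r ?nnegrE //.
  by apply: sumr_ge0.
rewrite mxE (le_trans (ler_norm_sum _ _ _)) // ler_sum // => j _.
by rewrite normrM ler_piMr // (le_trans (ler_enorm_coord x j)).
Qed.

Lemma opnorm_gt0 m n (M : 'M[R]_(m, n)) : M != 0 -> 0 < opnorm M.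
Proof.
move=> M0; have [i [j Mij]] : exists i j, M i j != 0.
  apply: contra_notP (elimN eqP M0) => /forallNP M0'.
  apply/matrixP => i j; rewrite mxE; apply/eqP/negPn/negP => Mij.
  by apply: (M0' i); exists j.
have ubM := @opnorm_bounded _ _ M.
rewrite (@lt_le_trans _ _ (enorm (M *m delta_mx j 0))) //.
  rewrite (lt_le_trans _ (ler_enorm_coord _ i)) //.
  by rewrite -colE mxE normr_gt0.
by apply: ub_le_sup => //; exists (delta_mx j 0) => //=; rewrite enorm_delta.
Qed.

(** For [t != 0] the difference quotient is exactly [a + t * b], so the derivative is read off an
    expansion along the line. *)
Lemma derive_quadratic n (f : 'cV[R]_n -> R) (v x : 'cV[R]_n) (a b : R) :
  (forall t, f (t *: v + x) = f x + t * a + t ^+ 2 * b) -> 'D_v f x = a.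
Proof.
move=> fq; apply: cvg_lim => //.
have abc : (fun t : R => a + t * b) @ 0^' --> a.
  rewrite -[X in _ --> X]addr0 -[X in _ --> _ + X](mul0r b).
  apply: cvgD; first exact: cvg_cst.
  by apply: cvgMl; apply: cvg_within_filter; exact: cvg_id.
apply: cvg_trans abc; apply: near_eq_cvg; near=> t.
have t0 : t != 0 by near: t; exact: nbhs_dnbhs_neq.
by rewrite /= fq /GRing.scale /=; field.
Unshelve. all: by end_near. Qed.

End euclidean.

(** * Continuous functions up to the end of an interval of positivity *)

Section positive_prefix.
Set Implicit Arguments.
Unset Strict Implicit.
Context {R : realType}.
Implicit Types (f : R -> R) (a b x y r : R).

Lemma within_continuous_gt0 f a b x :
  {within `[a, b], continuous f} -> a <= x <= b -> 0 < f x ->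
  exists2 r, 0 < r & forall y, a <= y <= b -> `|x - y| < r -> 0 < f y.
Proof.
move=> /subspace_continuousP fc xab fx0.
have /fc/cvgr_gt/(_ _ fx0) : `[a, b]%classic x by rewrite /= in_itv.
rewrite near_withinE => /nbhs_ballP[r /= r0 xr]; exists r => // y yab xy.
by apply: xr => //=; rewrite in_itv.
Qed.

(** Continuity at [0] makes [S] nonempty. A point below [sup S] lies below some element of [S], so
    [f] is positive there; at [sup S] itself only the limit inequality survives. *)
Lemma sup_positive_prefix f b (S := [set a : R | 0 < a <= b /\
    forall x, 0 <= x <= a -> 0 < f x]) :
  0 < b -> {within `[0, b], continuous f} -> 0 < f 0 ->
  [/\ 0 < sup S, sup S <= b & forall x, 0 <= x <= sup S -> 0 <= f x].
Proof.
move=> b0 fc f0.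
have [r r0 fr] : exists2 r, 0 < r &
    forall y, 0 <= y <= b -> `|0 - y| < r -> 0 < f y.
  by apply: within_continuous_gt0 => //; rewrite lexx ltW.
have Sm : S (Num.min b (r / 2)).
  split; first by rewrite lt_min b0 divr_gt0 //= ge_min lexx.
  move=> x /andP[x0]; rewrite le_min => /andP[xb xr]; apply: fr.
    by rewrite x0.
  by rewrite sub0r normrN ger0_norm //; lra.
have S0 : S !=set0 by exists (Num.min b (r / 2)).
have ubS : has_ubound S by exists b => a [/andP[]].
have supS0 : 0 < sup S.
  by apply: lt_le_trans (ub_le_sup ubS Sm); case: Sm => /andP[].
have supSb : sup S <= b by apply: ge_sup => // a [/andP[]].
have f_gt0 x : 0 <= x -> x < sup S -> 0 < f x.
  move=> x0 /(sup_gt S0)[a [_ fa]] xa; apply: fa.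
  by rewrite x0 ltW.
split=> // x /andP[x0]; rewrite le_eqVlt => /orP[/eqP ->|]; last first.
  by move=> /(f_gt0 _ x0)/ltW.
rewrite leNgt; apply/negP => fs.
have [|||e e0 fe] := @within_continuous_gt0 (fun x => - f x) 0 b (sup S).
- by move=> z; apply: continuousN; exact: fc.
- by rewrite ltW.
- by rewrite oppr_gt0.
(* [f (sup S) < 0] would make [f] negative at all points within [e]; [y] is such a point to the left
   of [sup S], kept in the domain by the maximum with [0]. *)
pose y := Num.max 0 (sup S - e / 2).
have ys : y < sup S by rewrite gt_max supS0 /=; lra.
have y0 : 0 <= y by rewrite le_max lexx.
have := f_gt0 _ y0 ys; apply/negP; rewrite -leNgt -oppr_ge0 ltW // fe //.
  by rewrite y0 (le_trans (ltW ys)).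
have : sup S - e / 2 <= y by rewrite le_max lexx orbT.
by move=> ey; rewrite ger0_norm ?subr_ge0 ?ltW //; lra.
Qed.

End positive_prefix.

(** The linear terms of the expanded product add up to [2 * k * alpha]. One [k * alpha] pays for the
    negative terms, and the cross term [c * g * del * alpha ^+ 2] is a gain that is discarded. *)
Lemma rate_gain (F : realFieldType) (c g del lam C k C' alpha ell : F) :
  0 < c -> 0 < g -> 0 < del -> 0 < C -> 0 < alpha <= 1 ->
  2 * k = c * (del + g * lam) -> C' = c * (1 + g) * C -> alpha * C' <= k ->
  lam + del * alpha - C * alpha ^+ 2 <= ell ->
  c * lam + k * alpha <= c * ((1 + alpha * g) * ell).
Proof.
move=> c0 g0 del0 C0 /andP[a0 a1] kE C'E ak ell_ge.
have ag0 : 0 < 1 + alpha * g by rewrite addr_gt0 // mulr_gt0.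
apply: (@le_trans _ _ (c * ((1 + alpha * g) *
    (lam + del * alpha - C * alpha ^+ 2)))); last first.
  by rewrite ler_pM2l // ler_pM2l.
have quad : alpha * (alpha * C') <= alpha * k by rewrite ler_pM2l.
have cubic : alpha ^+ 2 * (c * C * (1 + alpha * g)) <= alpha * (alpha * C').
  have -> : alpha * (alpha * C') = alpha ^+ 2 * (c * C * (1 + g)).
    by rewrite C'E; ring.
  rewrite ler_pM2l ?exprn_gt0 // ler_pM2l ?mulr_gt0 // lerD2l.
  by rewrite ler_piMl // ltW.
have gd : 0 <= c * (g * del * alpha ^+ 2).
  by rewrite ltW // !mulr_gt0 // exprn_gt0.
have -> : c * ((1 + alpha * g) * (lam + del * alpha - C * alpha ^+ 2)) =
    c * lam + alpha * (2 * k) + c * (g * del * alpha ^+ 2)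
    - alpha ^+ 2 * (c * C * (1 + alpha * g)).
  by rewrite kE; ring.
lra.
Qed.

(** * The Hessian of [B1] and nonvanishing of the corrector *)

Section hfhr.
Set Implicit Arguments.
Unset Strict Implicit.
Context {R : realType} {d : nat} (P : hfhr R d).

Lemma delta_mx_rshift (i : 'I_d) :
  delta_mx (rshift d i) 0 = col_mx 0 (delta_mx i 0) :> 'cV[R]_(d + d).
Proof.
apply/matrixP => k l; rewrite !mxE; case: splitP => j kj; rewrite !mxE.
  by rewrite -val_eqE /= kj ltn_eqF // ltn_addr.
by rewrite -!val_eqE /= kj eqn_add2l.
Qed.

Lemma pos_line_p (z : 'cV[R]_(d + d)) (i : 'I_d) (t : R) :
  pos_of (t *: delta_mx (rshift d i) 0 + z) = pos_of z.
Proof.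
by rewrite delta_mx_rshift /pos_of linearD linearZ /= col_mxKu scaler0 add0r.
Qed.

Lemma mom_line_p (z : 'cV[R]_(d + d)) (i : 'I_d) (t : R) :
  mom_of (t *: delta_mx (rshift d i) 0 + z) = mom_of z + t *: delta_mx i 0.
Proof.
by rewrite delta_mx_rshift /mom_of linearD linearZ /= col_mxKd addrC.
Qed.

(** Only [- (2^-1 * enorm p ^+ 2)] is quadratic in the momentum, whence the coefficient of [t ^+ 2];
    by [derive_quadratic] the coefficient of [t] is the partial derivative. *)
Lemma B1_line_p (z : 'cV[R]_(d + d)) (i : 'I_d) (t : R) :
  B1 P (t *: delta_mx (rshift d i) 0 + z) =
  B1 P z
  + t * (gamma P / 2 * (Qinf P *m pos_of z) i 0
         - mom_of z i 0 - gamma P / 2 * pos_of z i 0)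
  + t ^+ 2 * - 2^-1.
Proof.
rewrite /B1 pos_line_p mom_line_p !sqr_enorm !(dotDr, dotDl, dotZr).
rewrite !(dotC (t *: delta_mx i 0)) !dotZr !dot_delta.
rewrite [(delta_mx i 0 : 'cV[R]_d) i 0]mxE !eqxx /=.
by field.
Qed.

Lemma CB1_pp (i : 'I_d) : CB1 P (rshift d i) (rshift d i) = -1.
Proof.
rewrite mxE /partial.
under [X in 'D__ X _]eq_fun do rewrite (derive_quadratic (B1_line_p _ i)).
(* The first partial derivative is affine along the line, hence the quadratic coefficient [0]. *)
apply: (@derive_quadratic _ _ _ _ _ _ 0) => t.
rewrite pos_line_p mom_line_p [(mom_of _ + _) _ _]mxE.
have -> : (t *: delta_mx i 0 : 'cV[R]_d) i 0 = t by rewrite !mxE !eqxx mulr1.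
by ring.
Qed.

Lemma corrector_neq0 : (0 < d)%N -> corrector P -> Kcor P != 0.
Proof.
move=> d0 [_ KB]; apply/eqP => K0.
have /eqP := CB1_pp (Ordinal d0); rewrite -KB K0 mulmx0 mul0mx addr0 mxE.
by rewrite eq_sym oppr_eq0 oner_eq0.
Qed.

(** * Positivity of the constants and the rate on the Lyapunov branch *)

Context (HP : standing P) (HU : assumption1 P).

Lemma gamma_gt0 : 0 < gamma P. Proof. by case: HP. Qed.
Lemma Lip_gt0 : 0 < Lip P. Proof. by case: HU => -[]. Qed.
Lemma lam_gt0 : 0 < lam P. Proof. by case: HU => -[_ _ /andP[]]. Qed.
Lemma lam_le4 : lam P <= 4^-1. Proof. by case: HU => -[_ _ /andP[]]. Qed.

(* Squaring, [0 < mu_min P] reduces to 4 gamma^2 < 8 gamma^2 (1 - lam). *)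
Lemma c1_gt0 : 0 < c1 P.
Proof.
have g2 : 0 < gamma P ^+ 2 by rewrite exprn_gt0 // gamma_gt0.
have := lam_le4 => l4; rewrite lt_min ltr01 /= mulr_gt0 // subr_gt0.
have gl : gamma P ^+ 2 * 3 / 4 <= gamma P ^+ 2 * (1 - lam P).
  by rewrite -mulrA ler_pM2l //; lra.
rewrite -[ltRHS]ger0_norm; last by lra.
by rewrite -sqrtr_sqr ltr_sqrt; nra.
Qed.

Lemma CM_gt0 : corrector P -> 0 < CM P.
Proof.
by move=> KP; rewrite mulr_gt0 // opnorm_gt0 // corrector_neq0 //; case: HP.
Qed.

(* Strict positivity matters: with C_lambda = 0 the constant C' vanishes and the
   convention x / 0 = 0 would make alpha_branch_acc equal to 0. *)
Lemma C_lambda_gt0 : corrector P -> 0 < delta P -> 0 < C_lambda P.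
Proof.
move=> KP delta0; have CMt0 : 0 < CMtilde P by rewrite divr_gt0 ?CM_gt0 ?c1_gt0.
apply: ltr_pDl; last first.
  (* Positivity of [c_imp] is read off [0 < delta], that is [lam * CMtilde < c_imp]. *)
  rewrite mulr_gt0 //; move: delta0; rewrite subr_gt0; apply: lt_trans.
  by rewrite mulr_gt0 // lam_gt0.
apply: ltr_wpDl => //; apply: mulr_gt0; first by rewrite mulr_gt0 ?CM_gt0.
apply: divr_gt0; last exact: c1_gt0.
by rewrite ltr_pwDl ?Lip_gt0 ?enorm_ge0.
Qed.

(** The corrector enters through [0 < CM]: with [CM = 0] the entry [c1 / (2 * CM)] of the minimum
    would be [0] by the division convention. *)
Lemma alpha1_gt0 apos : corrector P -> 0 < apos -> 0 < alpha1 P apos.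
Proof.
move=> KP apos0; have g0 := gamma_gt0; have l4 := lam_le4.
have g2 : 0 < gamma P ^+ 2 by rewrite exprn_gt0.
rewrite !lt_min ltr01 apos0 andbT /=; apply/andP; split; last first.
  by apply: divr_gt0; [exact: c1_gt0|rewrite mulr_gt0 ?CM_gt0].
apply: mulr_gt0; first by rewrite divr_gt0 ?mulr_gt0 ?lam_gt0.
rewrite invr_gt0 -addrA ltr_pwDl ?addr_ge0 //.
- rewrite mulr_gt0 ?invr_gt0 ?c1_gt0 // ltr_wpDl ?divr_gt0 //.
  by rewrite mulr_ge0 ?sqr_ge0 // divr_ge0 // exprn_ge0 // ltW.
- by rewrite mulr_ge0 // ltW // Lip_gt0.
- apply: mulr_ge0; last by lra.
  by rewrite mulr_ge0 // divr_ge0 // ltW.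
Qed.

Lemma rate_lyapunov_branch alpha ell :
  tLam1 P alpha ell <= tLam2 P alpha ell ->
  tLam1 P alpha ell <= tLam3 P alpha ell ->
  rate P alpha ell = Lip P / (384 * gamma P) * ((1 + alpha * gamma P) * ell).
Proof.
move=> l12 l13; rewrite /rate min_l ?le_min ?l12 // /tLam1 /Leff.
by field; rewrite lt0r_neq0 // gamma_gt0.
Qed.

End hfhr.

Theorem theorem4p12 (R : realType) (d : nat) (P : hfhr R d)
    (apos : R) (lam_ : R -> R)
    (Hstanding : standing P)
    (Hass1 : assumption1 P)
    (Hass2 : assumption2 P)
    (Hcorrector : corrector P)
    (Hapos : is_alpha_pos P apos)
    (Hdrift : drift_rates P apos lam_)
    (Hdelta : 0 < delta P)
    (HClambda : 0 <= C_lambda P)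
    (Hactive2 : tLam1 P 0 (lam P) < tLam2 P 0 (lam P))
    (Hactive3 : tLam1 P 0 (lam P) < tLam3 P 0 (lam P))
    (Hcont1 : {within `[0, alpha1 P apos],
                 continuous (fun alpha : R => tLam1 P alpha (lam_ alpha))})
    (Hcont2 : {within `[0, alpha1 P apos],
                 continuous (fun alpha : R => tLam2 P alpha (lam_ alpha))})
    (Hcont3 : {within `[0, alpha1 P apos],
                 continuous (fun alpha : R => tLam3 P alpha (lam_ alpha))}) :
  0 < alpha_branch_acc P apos lam_ <= alpha_branch P apos lam_ /\
  forall alpha : R, 0 < alpha <= alpha_branch_acc P apos lam_ ->
    rate P 0 (lam P) + kappa P * alpha <= rate P alpha (lam_ alpha).
Proof.
have g0 := gamma_gt0 Hstanding; have L0 := Lip_gt0 Hass1; have l0 := lam_gt0 Hass1.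
have C0 := C_lambda_gt0 Hstanding Hass1 Hcorrector Hdelta.
have a10 := alpha1_gt0 Hstanding Hass1 Hcorrector (proj1 Hapos).
have [lam_0 lam_drift] := Hdrift.
have [ab0 abmax Delta_ge0] : [/\ 0 < alpha_branch P apos lam_,
    alpha_branch P apos lam_ <= alpha1 P apos &
    forall x, 0 <= x <= alpha_branch P apos lam_ -> 0 <= Delta P lam_ x].
  (* [alpha_branch] unfolds to the supremum of this lemma for [f = Delta]; strict activity at [0]
     gives [0 < Delta 0]. *)
  apply: sup_positive_prefix => //; last first.
    by rewrite /Delta lam_0 subr_gt0 lt_min Hactive2.
  move=> x; apply: (@continuousB _ R^o (subspace `[0, alpha1 P apos])
    ((fun a => tLam2 P a (lam_ a)) \min (fun a => tLam3 P a (lam_ a)))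
    (fun a => tLam1 P a (lam_ a)) x); last exact: Hcont1.
  by apply: continuous_min; [exact: Hcont2|exact: Hcont3].
have ng0 n : (0 < n)%N -> 0 < n%:R * gamma P.
  by move=> n0; apply: mulr_gt0; first by rewrite ltr0n.
have k0 : 0 < kappa P.
  apply: divr_gt0; last exact: ng0.
  by apply: (mulr_gt0 L0); apply: (addr_gt0 Hdelta); exact: mulr_gt0.
set c := Lip P / (384 * gamma P).
have c0 : 0 < c by apply: (divr_gt0 L0); exact: ng0.
have C'0 : 0 < C' P.
  apply: mulr_gt0; last exact: C0.
  by apply: (mulr_gt0 c0); exact: addr_gt0.
have kE : 2 * kappa P = c * (delta P + gamma P * lam P).
  by rewrite /kappa /c; field; exact: lt0r_neq0.
split=> [|alpha].
  apply/andP; split; last by rewrite ge_min lexx.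
  by rewrite !lt_min ab0 ltr01; exact: divr_gt0.
rewrite !le_min (ler_pdivlMr _ _ C'0) => /andP[a0 /and3P[a_branch a_le1 ak]].
(* The weak inequality suffices, since a tie between branches leaves the minimum equal to [tLam1];
   this covers the endpoint [alpha_branch]. *)
have : 0 <= Delta P lam_ alpha by apply: Delta_ge0; rewrite (ltW a0).
rewrite subr_ge0 le_min => /andP[l12 l13].
(* At [alpha = 0] the factor [1 + alpha * gamma] is 1, so the kinetic rate becomes [c * lam]. *)
rewrite (rate_lyapunov_branch Hstanding (ltW Hactive2) (ltW Hactive3)).
rewrite (rate_lyapunov_branch Hstanding l12 l13) mul0r addr0 mul1r.
have [|_ lam_ge] := lam_drift alpha.
  by rewrite a0 (le_trans a_branch abmax).
by apply: (rate_gain c0 g0 Hdelta C0 _ kE _ ak lam_ge); rewrite ?a0.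
Qed.
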